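(* Let $\mathsf{A}$, $\mathcal{X}$, $\Sigma$, a sequence $(\sigma_i)_{i\in\mathbb{N}}\subseteq\Sigma$, and the measures $\delta_{x,\sigma}$ be such that $\sigma_i\to\sigma_0$ as $i\to\infty$, there exist $e\in\mathrm{lin}\{b_1,\dots,b_m\}$ and $N\in\mathbb{N}$ with $e(x,\sigma_i)>0$ for all $x\in\mathcal{X}$ and all $i\geq N$, and the range of $t_{\mathsf{A}}\cdot\|t_{\mathsf{A}}\|^{-1}$ consists of not more than $m-1$ path-connected components. Then \[\mathcal{C}^M_{\mathsf{A}}\leq m-1.\]
   Context: Setting. $\mathcal{X}$ is a topological space, $\Sigma$ is a set of parameters contained in a larger metric space, and for every $(\xi,\sigma)\in\mathcal{X}\times\Sigma$ a probability measure $\delta_{\xi,\sigma}$ on $\mathcal{X}$ is given. $\mathsf{A}=\{a_1,\dots,a_m\}$ is a set of $m$ linearly independent continuous functions $a_i:\mathcal{X}\to\mathbb{R}$ with $\left|\int_{\mathcal{X}} a_i\,\mathrm{d}\delta_{\xi,\sigma}\right|<\infty$ for all $(\xi,\sigma)\in\mathcal{X}\times\Sigma$. There is $\sigma_0\in\overline{\Sigma}$ such that $\lim_{\Sigma\ni\sigma\to\sigma_0}\int_{\mathcal{X}} a_i\,\mathrm{d}\delta_{\xi,\sigma}=a_i(\xi)$ for all $\xi\in\mathcal{X}$ and $i=1,\dots,m$. Notation. $b_i(x,\sigma):=\int_{\mathcal{X}} a_i(y)\,\mathrm{d}\delta_{x,\sigma}(y)$ on $\mathcal{X}\times\Sigma$,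 and $\mathrm{lin}$ denotes the linear span. $t_{\mathsf{A}}:\mathcal{X}\times\Sigma\to\mathbb{R}^m$, $t_{\mathsf{A}}(x,\sigma):=(b_i(x,\sigma))_{i=1}^m$. The range of $t_{\mathsf{A}}\cdot\|t_{\mathsf{A}}\|^{-1}$ is the set of vectors $t_{\mathsf{A}}(x,\sigma)/\|t_{\mathsf{A}}(x,\sigma)\|$, $(x,\sigma)\in\mathcal{X}\times\Sigma$, in the unit sphere of $\mathbb{R}^m$. $\mathcal{T}_{\mathsf{A}}:=\left\{\sum_{i=1}^m c_i\,t_{\mathsf{A}}(x_i,\sigma_i)\,\middle|\,c_i\geq0,\ (x_i,\sigma_i)\in\mathcal{X}\times\Sigma\right\}$. For $s\in\mathcal{T}_{\mathsf{A}}$, $\mathcal{C}^M_{\mathsf{A}}(s)$ is the smallest $k$ such that $s=\sum_{i=1}^k c_i\,t_{\mathsf{A}}(x_i,\sigma_i)$ for some $c_i>0$, $(x_i,\sigma_i)\in\mathcal{X}\times\Sigma$. $\mathcal{C}^M_{\mathsf{A}}:=\max_{s\in\mathcal{T}_{\mathsf{A}}}\mathcal{C}^M_{\mathsf{A}}(s)$. *)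

(* Defs.v *)
From HB Require Import structures.
From mathcomp Require Import all_boot all_order all_algebra.
From mathcomp Require Import all_classical all_reals all_analysis.

Set Implicit Arguments.
Unset Strict Implicit.
Unset Printing Implicit Defensive.

Import Order.TTheory GRing.Theory Num.Theory.
Import numFieldNormedType.Exports.

Local Open Scope classical_set_scope.
Local Open Scope ring_scope.

(* X with its Borel sigma-algebra.  The library asks measurable spaces to be
   pointed, hence ptopologicalType. *)
Definition borel (X : ptopologicalType) := g_sigma_algebraType (@open X).

Definition lin_indep (R : realType) (T : Type) (m : nat)
    (a : 'I_m -> T -> R) : Prop :=
  forall c : 'I_m -> R,
    (forall x, \sum_(i < m) c i * a i x = 0) -> forall i, c i = 0.

(* The norm carried by 'rV[R]_m in the library is the sup norm. *)
Definition eucl_norm (R : realType) (m : nat) (v : 'rV[R]_m) : R :=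
  Num.sqrt (\sum_(i < m) v ord0 i ^+ 2).

Definition path_joined (R : realType) (T : topologicalType) (S : set T)
    (u v : T) : Prop :=
  exists gamma : R -> T,
    [/\ {within `[0, 1], continuous gamma},
        gamma 0 = u, gamma 1 = v & gamma @` `[0, 1] `<=` S].

Definition path_components (R : realType) (T : topologicalType) (S : set T) :
    set (set T) :=
  [set C | exists2 u, S u & C = [set v | path_joined R S u v]].

Section Mixtures.
Variables (R : realType) (X : ptopologicalType) (M : metricType R).
(* The values of delta at parameters outside Sigma are junk, never constrained
   nor used in the statement. *)
Variables (Sigma : set M) (delta : X -> M -> probability (borel X) R).
Variables (m : nat) (a : 'I_m -> X -> R).

Definition mix (i : 'I_m) (x : X) (s : M) : R :=
  \int[delta x s]_(y in [set: borel X]) a i y.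

Definition in_lin_mix (e : X -> M -> R) : Prop :=
  exists c : 'I_m -> R,
    forall x s, Sigma s -> e x s = \sum_(i < m) c i * mix i x s.

Definition mix_vec (x : X) (s : M) : 'rV[R]_m := \row_(i < m) mix i x s.

(* t / ||t|| is defined only where t does not vanish; the condition is needed
   because 0^-1 = 0 would otherwise put the zero vector in the range. *)
Definition normalized_range : set 'rV[R]_m :=
  [set v | exists x s, [/\ Sigma s, mix_vec x s != 0 &
     v = (eucl_norm (mix_vec x s))^-1 *: mix_vec x s]].

Definition mix_cone : set 'rV[R]_m :=
  [set v | exists (n : nat) (c : 'I_n -> R) (x : 'I_n -> X) (s : 'I_n -> M),
     [/\ forall i, 0 <= c i, forall i, Sigma (s i) &
         v = \sum_(i < n) c i *: mix_vec (x i) (s i)]].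

Definition has_atoms (v : 'rV[R]_m) (k : nat) : Prop :=
  exists (c : 'I_k -> R) (x : 'I_k -> X) (s : 'I_k -> M),
    [/\ forall i, 0 < c i, forall i, Sigma (s i) &
        v = \sum_(i < k) c i *: mix_vec (x i) (s i)].

(* k is the smallest number of atoms representing v; the zero vector has
   number 0 (empty sum). *)
Definition is_cara_number_at (v : 'rV[R]_m) (k : nat) : Prop :=
  has_atoms v k /\ forall l, has_atoms v l -> (k <= l)%N.

(* n is the maximum over the cone of the numbers above, as a relation so that
   existence of the minima and of the maximum is not presupposed. *)
Definition is_cara_number (n : nat) : Prop :=
  (exists2 v, mix_cone v & is_cara_number_at v n) /\
  (forall v, mix_cone v -> exists2 k, is_cara_number_at v k & (k <= n)%N).

End Mixtures.

(* Main.v *)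
(* Let e = sum_i c_i b_i be the given function.  Letting sigma_n -> sigma_0 in
   e(x, sigma_n) > 0 gives sum_i c_i a_i >= 0 on X, and integrating gives
   e >= 0 on all of X x Sigma, so the functional c is nonnegative on the
   normalized range S, though it may vanish there.  Let K be the convex cone
   generated by the points of S where c is positive.  A functional nonnegative
   on K is nonnegative on every a(x) and hence, after integration, on S: by
   bipolarity S lies in the closure of K.

   Suppose that v in the cone of S needs m points.  Then v is a combination with
   positive coefficients of a basis contained in S, so it is interior to the
   closure of K, hence it lies in K, and by Caratheodory v = sum_k d_k s_k with
   d_k > 0 for a basis s of points of S where c is positive.  Two of
   these m points, s_i and s_j, lie in the same path component of S.  Moving s_i
   along a path to s_j within S, some coefficient must vanish on the way; the
   only obstruction would be a point of the path in the cone of the - s_k,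
   which is excluded by the signs of c. *)
Require Import Defs.
From HB Require Import structures.
From mathcomp Require Import all_boot all_order all_algebra.
From mathcomp Require Import all_classical all_reals all_analysis.
From mathcomp Require Import ring lra.

Set Implicit Arguments.
Unset Strict Implicit.
Unset Printing Implicit Defensive.

Import Order.TTheory GRing.Theory Num.Theory.
Import numFieldNormedType.Exports.

Local Open Scope classical_set_scope.
Local Open Scope ring_scope.

(** * Euclidean inner product of row vectors *)

Definition dot (R : realType) (m : nat) (u v : 'rV[R]_m) : R :=
  \sum_(i < m) u ord0 i * v ord0 i.

Section Dot.
Variables (R : realType) (m : nat).
Implicit Types u v w : 'rV[R]_m.

Lemma dotC u v : dot u v = dot v u.
Proof. by apply: eq_bigr => i _; rewrite mulrC. Qed.

Lemma dotDr u v w : dot u (v + w) = dot u v + dot u w.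
Proof. by rewrite -big_split; apply: eq_bigr => i _; rewrite mxE mulrDr. Qed.

Lemma dotZr u k v : dot u (k *: v) = k * dot u v.
Proof. by rewrite /dot mulr_sumr; apply: eq_bigr => i _; rewrite mxE mulrCA. Qed.

Lemma dot0r u : dot u 0 = 0.
Proof. by rewrite /dot big1 // => i _; rewrite mxE mulr0. Qed.

Lemma dotNr u v : dot u (- v) = - dot u v.
Proof. by rewrite -scaleN1r dotZr mulN1r. Qed.

Lemma dotDl u v w : dot (u + v) w = dot u w + dot v w.
Proof. by rewrite dotC dotDr !(dotC w). Qed.

Lemma dotZl u k v : dot (k *: u) v = k * dot u v.
Proof. by rewrite dotC dotZr dotC. Qed.

Lemma dot_sumr (I : finType) (P : pred I) u (F : I -> 'rV[R]_m) :
  dot u (\sum_(i | P i) F i) = \sum_(i | P i) dot u (F i).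
Proof. by elim/big_rec2: _ => [|i x y _ <-]; rewrite ?dot0r ?dotDr. Qed.

Lemma dot_ge0 u : 0 <= dot u u.
Proof. by apply: sumr_ge0 => i _; rewrite -expr2 sqr_ge0. Qed.

(** The norm is the sup norm, attained at one entry, whose square is a single term of the sum. It
    serves to bound Euclidean sublevel sets. *)
Lemma sqr_norm_le_dot u : `|u| ^+ 2 <= dot u u.
Proof.
have -> : `|u| = mx_norm u by [].
have [->|u0] := eqVneq (mx_norm u) 0; first by rewrite expr0n dot_ge0.
have [[i j] uij] := mx_norm_neq0 u0.
rewrite uij real_normK ?num_real //= (ord1 i) /dot (bigD1 j) //=.
by rewrite -expr2 lerDl; apply: sumr_ge0 => k _; rewrite -expr2 sqr_ge0.
Qed.

Lemma dot_eq0 u : dot u u <= 0 -> u = 0.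
Proof.
move=> u0; apply/eqP; rewrite -normr_eq0 -sqrf_eq0; apply/eqP/le_anti.
by rewrite sqr_ge0 andbT (le_trans (sqr_norm_le_dot u)).
Qed.

End Dot.

Lemma continuous_sumr (R : realType) (T : topologicalType) (I : Type)
    (r : seq I) (P : pred I) (F : I -> T -> R) :
  (forall i, P i -> continuous (F i)) ->
  continuous (fun x => \sum_(i <- r | P i) F i x).
Proof.
move=> Fc x; apply: cvg_big => [|i Pi]; last exact: Fc.
by move=> [a b]; exact: (@cvgD _ R^o _ _ _ fst snd a b cvg_fst cvg_snd).
Qed.

Lemma dot_self_continuous (R : realType) (m : nat) (w : 'rV[R]_m) :
  continuous (fun x : 'rV[R]_m => dot (x - w) (x - w)).
Proof.
have c1 i : continuous (fun x : 'rV[R]_m => (x - w) ord0 i).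
  move=> x; apply: (@continuous_comp 'rV[R]_m 'rV[R]_m R
    (fun x : 'rV[R]_m => x - w) (fun y : 'rV[R]_m => y ord0 i)).
    by apply: continuousB => //; exact: cst_continuous.
  exact: coord_continuous.
by apply: continuous_sumr => i _ x; apply: (@continuousM R); exact: c1.
Qed.

(** * Closures of convex cones and bipolarity *)

Section Cone.
Variables (R : realType) (m : nat) (K : set 'rV[R]_m).
Hypotheses (K0 : K 0) (KD : forall u v, K u -> K v -> K (u + v)).
Hypothesis KZ : forall k u, 0 < k -> K u -> K (k *: u).

Lemma closure_coneD u v : closure K u -> K v -> closure K (u + v).
Proof.
move=> Ku Kv B Bu.
have /Ku [x [Kx Bx]] : nbhs u ((fun x => x + v) @^-1` B).
  have : {for u, continuous (fun x : 'rV[R]_m => x + v)}.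
    by apply: continuousD => //; exact: cst_continuous.
  exact.
by exists (x + v); split => //; exact: KD.
Qed.

Lemma closure_coneZ k u : 0 < k -> closure K u -> closure K (k *: u).
Proof.
move=> k0 Ku B Bu.
have /Ku [x [Kx Bx]] : nbhs u ((fun x => k *: x) @^-1` B).
  have : {for u, continuous (fun x : 'rV[R]_m => k *: x)}.
    by apply: scaler_continuous.
  exact.
by exists (k *: x); split => //; exact: KZ.
Qed.

(** Projection argument: for [p] nearest to [w] in the closure, [p - w] is nonnegative on [K], hence
    at [w], which forces [p = w]. *)
Lemma closure_bipolar (w : 'rV[R]_m) :
  (forall f, (forall g, K g -> 0 <= dot f g) -> 0 <= dot f w) -> closure K w.
Proof.
move=> polar_w.
pose q x := dot (x - w) (x - w).
pose A := closure K `&` [set x | q x <= q 0].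
have A0 : A 0 by split; [exact: subset_closure|rewrite /= lexx].
have Aclosed : closed A.
  apply: closedI; first exact: closed_closure.
  exact: (@closed_comp _ _ q _ (fun x _ => @dot_self_continuous _ _ w x)
    (@closed_le _ (q 0))).
have Abounded : bounded_set A.
  (* A number whose square is at most [q 0] is itself at most [1 + q 0]. *)
  exists (`|w| + (1 + q 0)); split; first exact: num_real.
  move=> B /ltW leB x [_ /= qx]; apply: le_trans leB.
  rewrite -{1}(subrK w x) addrC (le_trans (ler_normD _ _))// lerD2l.
  have := sqr_norm_le_dot (x - w); rewrite -/(q x) => /le_trans /(_ qx).
  nra.
have [|p pA pmin] := compact_EVT_min _ (bounded_closed_compact Abounded Aclosed)
  (continuous_subspaceT (@dot_self_continuous _ _ w)).
  by exists 0.
(* Minimality extends from [A] to the whole closure: outside [A] the value exceeds [q 0]. *)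
have {}pmin x : closure K x -> q p <= q x.
  move=> Kx; have [qx|/ltW qx] := leP (q x) (q 0).
    by apply: pmin; rewrite inE.
  by apply: le_trans qx; apply: pmin; rewrite inE.
move: pA; rewrite inE => -[Kp _].
(* [p] is the point of the closure nearest to [w]: no feasible direction [g]
   decreases the distance to first order, so [p - w] is a polar vector. *)
have vari g (t0 : R) : 0 < t0 -> (forall t, 0 < t < t0 -> closure K (p + t *: g)) ->
    0 <= dot (p - w) g.
  move=> t00 Kg; rewrite leNgt; apply/negP => neg.
  have qE t : q (p + t *: g) = q p + t * (2 * dot (p - w) g + t * dot g g).
    rewrite /q addrAC; move: (p - w) => d.
    by rewrite !dotDr !dotDl !dotZl !dotZr (dotC g); ring.
  have G0 := dot_ge0 g.
  set D := dot (p - w) g in neg qE; set G := dot g g in G0 qE.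
  (* The second bound makes [2 * D + t * G] negative, against minimality of [p]; the [+ 1] keeps the
     divisor positive. *)
  pose t := Num.min (t0 / 2) (- D / (G + 1)).
  have t_gt0 : 0 < t.
    by rewrite lt_min; apply/andP; split; [lra|apply: divr_gt0; lra].
  have tG : t * (G + 1) <= - D.
    by rewrite -ler_pdivlMr; [rewrite ge_min lexx orbT|lra].
  have t_lt : t < t0.
    by rewrite gt_min; apply/orP; left; lra.
  have := pmin _ (Kg t _); rewrite t_gt0 t_lt => /(_ isT).
  by rewrite qE lerDl pmulr_rge0 //; lra.
have f_ge0 g : K g -> 0 <= dot (p - w) g.
  move=> Kg; apply: (vari g 1) => // t /andP[t0 _].
  by apply: closure_coneD => //; exact: KZ.
(* The direction [- p] is feasible: it leads to [(1 - t) *: p], in the closure for [t < 1]. *)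
have fp_le0 : dot (p - w) p <= 0.
  rewrite -oppr_ge0 -dotNr; apply: (vari _ 1) => // t /andP[t0 t1].
  rewrite scalerN -{1}[p]scale1r -scalerBl; apply: closure_coneZ => //.
  by rewrite subr_gt0.
have /polar_w fw := f_ge0.
have /dot_eq0/subr0_eq <- // : q p <= 0.
by rewrite /q dotDr dotNr subr_le0 (le_trans fp_le0).
Qed.

End Cone.

(** * Positive combinations, Caratheodory reduction and exchange of a vector *)

Definition pos_comb (R : realType) (m : nat) (S : set 'rV[R]_m) (n : nat)
    (v : 'rV[R]_m) : Prop :=
  exists (c : 'I_n -> R) (s : 'I_n -> 'rV[R]_m),
    [/\ forall i, 0 < c i, forall i, S (s i) & v = \sum_(i < n) c i *: s i].

(** A rank condition, so that for [n = m] the matrix is invertible and its inverse yields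
    coordinates. *)
Definition independent (R : realType) (m n : nat) (s : 'I_n -> 'rV[R]_m) :=
  row_free (\matrix_(i < n) s i).

Section PosComb.
Variables (R : realType) (m : nat).
Implicit Types (S : set 'rV[R]_m) (v : 'rV[R]_m).

Lemma mulmx_family n (s : 'I_n -> 'rV[R]_m) (x : 'rV[R]_n) :
  x *m \matrix_(i < n) s i = \sum_(i < n) x ord0 i *: s i.
Proof. by rewrite mulmx_sum_row; apply: eq_bigr => i _; rewrite rowK. Qed.

Lemma independentP n (s : 'I_n -> 'rV[R]_m) :
  (forall x : 'I_n -> R, \sum_(i < n) x i *: s i = 0 -> forall i, x i = 0) <->
  independent s.
Proof.
split=> [h|sfree x x0 i].
  apply: inj_row_free => x; rewrite mulmx_family => /h x0.
  by apply/rowP => i; rewrite x0 mxE.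
have : (\row_i x i) *m \matrix_(i < n) s i = 0 *m \matrix_(i < n) s i.
  by rewrite mul0mx mulmx_family -[RHS]x0; apply: eq_bigr => j _; rewrite mxE.
by move/(row_free_inj sfree)/rowP/(_ i); rewrite !mxE.
Qed.

Lemma independent_size n (s : 'I_n -> 'rV[R]_m) : independent s -> (n <= m)%N.
Proof. by rewrite /independent /row_free => /eqP <-; exact: rank_leq_col. Qed.

Lemma basis_coord (s : 'I_m -> 'rV[R]_m) v : independent s ->
  v = \sum_(i < m) (v *m invmx (\matrix_i s i)) ord0 i *: s i.
Proof.
by move=> sfree; rewrite -mulmx_family mulmxKV // -row_free_unit.
Qed.

Lemma pos_comb_nonneg S n (c : 'I_n -> R) (s : 'I_n -> 'rV[R]_m) :
  (forall i, 0 <= c i) -> (forall i, c i != 0 -> S (s i)) ->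
  pos_comb S #|[pred i | c i != 0]| (\sum_(i < n) c i *: s i).
Proof.
move=> c0 Ss; exists (fun i => c (enum_val i)), (fun i => s (enum_val i)).
have ci i : c (@enum_val _ [pred i | c i != 0] i) != 0 by exact: (enum_valP i).
split=> [i|i|]; first by rewrite lt_def ci c0.
  exact: Ss.
rewrite -(big_enum_val (fun i => c i *: s i)) /=.
rewrite [RHS]big_mkcond /=; apply: eq_bigr => i _.
by rewrite inE; case: eqVneq => // ->; rewrite scale0r.
Qed.

Lemma pos_comb_drop S n (c : 'I_n -> R) (s : 'I_n -> 'rV[R]_m) j :
  (forall i, 0 <= c i) -> (forall i, c i != 0 -> S (s i)) -> c j = 0 ->
  exists2 k, (k < n)%N & pos_comb S k (\sum_(i < n) c i *: s i).
Proof.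
move=> c0 Ss cj; exists #|[pred i | c i != 0]|; last exact: pos_comb_nonneg.
rewrite -[X in (_ < X)%N]card_ord; apply: proper_card; apply/properP; split.
  exact: subset_predT.
by exists j => //; rewrite inE cj eqxx.
Qed.

(** The least ratio [c i / x i] over [0 < x i] is the largest multiple of the relation [x] that can
    be subtracted with all coefficients staying nonnegative; the minimizing index drops out. *)
Lemma pos_comb_shrink S n (c : 'I_n -> R) (s : 'I_n -> 'rV[R]_m) (x : 'I_n -> R) j :
  (forall i, 0 < c i) -> (forall i, S (s i)) ->
  \sum_(i < n) x i *: s i = 0 -> 0 < x j ->
  exists2 k, (k < n)%N & pos_comb S k (\sum_(i < n) c i *: s i).
Proof.
move=> c0 Ss x0 xj.
pose i0 := [arg min_(i < j | 0 < x i) (c i / x i)]%O.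
have [xi0 i0min] : 0 < x i0 /\ forall i, 0 < x i -> c i0 / x i0 <= c i / x i.
  by rewrite /i0; case: arg_minP => // i xi imin; split.
pose t := c i0 / x i0.
have -> : \sum_(i < n) c i *: s i = \sum_(i < n) (c i - t * x i) *: s i.
  under [RHS]eq_bigr do rewrite scalerBl -scalerA.
  by rewrite sumrB -scaler_sumr x0 scaler0 subr0.
apply: (@pos_comb_drop _ _ _ _ i0) => // [i|]; last first.
  by rewrite /t divfK ?subrr // gt_eqF.
have t0 : 0 < t by rewrite divr_gt0.
rewrite subr_ge0; have [xi|xi] := ltP 0 (x i).
  by rewrite -ler_pdivlMr // i0min.
by rewrite (le_trans _ (ltW (c0 i))) // pmulr_rle0.
Qed.

(** As long as the family is dependent, a relation, taken with the sign that gives it a positive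
    coefficient, shortens the combination. *)
Lemma caratheodory S n v : pos_comb S n v ->
  exists (k : nat) (c : 'I_k -> R) (s : 'I_k -> 'rV[R]_m),
    [/\ forall i, 0 < c i, forall i, S (s i), v = \sum_(i < k) c i *: s i
      & independent s].
Proof.
elim/ltn_ind: n v => n IH v [c [s [c0 Ss ->]]].
have [sfree|] := pselect (independent s); first by exists n, c, s.
move=> dep; suff [k kn] : exists2 k, (k < n)%N & pos_comb S k (\sum_(i < n) c i *: s i).
  by move/(IH _ kn).
have [x /not_implyP[x0 /existsNP[j /eqP xj]]] :
    exists x : 'I_n -> R, ~ (\sum_(i < n) x i *: s i = 0 -> forall i, x i = 0).
  by apply/existsNP => h; apply: dep; apply/independentP.
have [xlt|xgt|/eqP] := ltgtP (x j) 0; last by rewrite (negbTE xj).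
  apply: (@pos_comb_shrink _ _ _ _ (fun i => - x i) j) => //.
    under eq_bigr do rewrite scaleNr.
    by rewrite sumrN x0 oppr0.
  by rewrite oppr_gt0.
exact: (@pos_comb_shrink _ _ _ _ x j).
Qed.

Lemma pos_comb0 S : pos_comb S 0 0.
Proof. by exists (fun=> 0), (fun=> 0); split; [case|case|rewrite big_ord0]. Qed.

Lemma pos_combD S n1 n2 u v :
  pos_comb S n1 u -> pos_comb S n2 v -> pos_comb S (n1 + n2) (u + v).
Proof.
move=> [c [s [c0 Ss ->]]] [d [t [d0 St ->]]].
exists (fun i => match fintype.split i with inl j => c j | inr j => d j end),
  (fun i => match fintype.split i with inl j => s j | inr j => t j end).
split=> [i|i|]; [by case: fintype.split|by case: fintype.split|].
rewrite big_split_ord /=; congr +%R; apply: eq_bigr => i _.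
  by rewrite -[lshift _ _]/(unsplit (inl i)) unsplitK.
by rewrite -[rshift _ _]/(unsplit (inr i)) unsplitK.
Qed.

Lemma pos_combZ S n k u : 0 < k -> pos_comb S n u -> pos_comb S n (k *: u).
Proof.
move=> k0 [c [s [c0 Ss ->]]]; exists (fun i => k * c i), s; split=> // [i|].
  by rewrite mulr_gt0.
by rewrite scaler_sumr; apply: eq_bigr => i _; rewrite scalerA.
Qed.

Lemma pos_comb_sum S (I : Type) (r : seq I) (F : I -> 'rV[R]_m) :
  (forall i, exists n, pos_comb S n (F i)) ->
  exists n, pos_comb S n (\sum_(i <- r) F i).
Proof.
move=> h; elim/big_ind: _ => [|u v [n1 h1] [n2 h2]|i _]; last exact: h.
  by exists 0%N; exact: pos_comb0.
by exists (n1 + n2)%N; exact: pos_combD.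
Qed.

Lemma exchange_sum n (s : 'I_n -> 'rV[R]_m) (c al : 'I_n -> R) i : al i != 0 ->
  \sum_(k < n) c k *: s k = (c i / al i) *: (\sum_(k < n) al k *: s k)
    + \sum_(k < n | k != i) (c k - c i / al i * al k) *: s k.
Proof.
move=> ali; rewrite (bigD1 i) //= [in RHS](bigD1 i) //= scalerDr scalerA divfK //.
rewrite -addrA; congr +%R; rewrite scaler_sumr -big_split; apply: eq_bigr => k _.
by rewrite /= scalerA -scalerDl addrC subrK.
Qed.

Definition subst_at n (T : Type) (s : 'I_n -> T) i w k := if k == i then w else s k.

Lemma subst_sum n (s : 'I_n -> 'rV[R]_m) (c al : 'I_n -> R) i : al i != 0 ->
  \sum_(k < n) c k *: s k =
  \sum_(k < n) subst_at (fun k => c k - c i / al i * al k) i (c i / al i) k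
     *: subst_at s i (\sum_(k < n) al k *: s k) k.
Proof.
move=> ali; rewrite (exchange_sum _ _ ali) [RHS](bigD1 i) //= /subst_at eqxx.
by congr +%R; apply: eq_bigr => k /negbTE ->.
Qed.

(** Expanded in the old family, a relation [x] has coefficient [x i * al i] at [i]; hence [x i = 0],
    and then the other coefficients vanish. *)
Lemma subst_independent n (s : 'I_n -> 'rV[R]_m) (al : 'I_n -> R) i : al i != 0 ->
  independent s -> independent (subst_at s i (\sum_(k < n) al k *: s k)).
Proof.
move=> ali /independentP sfree; apply/independentP => x.
rewrite (bigD1 i) //= /subst_at eqxx => x0.
have xE : \sum_(k < n) (x i * al k + (if k == i then 0 else x k)) *: s k = 0.
  rewrite -[RHS]x0; under [LHS]eq_bigr do rewrite scalerDl.
  rewrite big_split /= scaler_sumr; congr +%R.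
    by apply: eq_bigr => k _; rewrite scalerA.
  rewrite [RHS]big_mkcond /=; apply: eq_bigr => k _.
  by case: eqP => //; rewrite scale0r.
have {}xE := sfree _ xE.
have xi : x i = 0.
  by have /eqP := xE i; rewrite eqxx addr0 mulf_eq0 (negbTE ali) orbF => /eqP.
by move=> k; have := xE k; rewrite xi mul0r add0r; case: eqP => // ->.
Qed.

End PosComb.

(** * Coordinates in a basis and their continuity under exchange *)

Lemma continuous_bigmin (R : realType) (T : topologicalType) (I : Type)
    (r : seq I) (P : pred I) (x0 : R) (F : I -> T -> R) :
  (forall i, P i -> continuous (F i)) ->
  continuous (fun x => \big[Num.min/x0]_(i <- r | P i) F i x).
Proof.
move=> Fc x; apply: cvg_big => [|i Pi]; last exact: Fc.
exact: min_continuous.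
Qed.

Section Bases.
Variables (R : realType) (m : nat).
Implicit Types (S K : set 'rV[R]_m).

Definition coord (s : 'I_m -> 'rV[R]_m) (k : 'I_m) (x : 'rV[R]_m) : R :=
  (x *m invmx (\matrix_i s i)) ord0 k.

Lemma coord_sum s x : independent s -> x = \sum_(k < m) coord s k x *: s k.
Proof. exact: basis_coord. Qed.

Lemma coord_basis s i k : independent s -> coord s k (s i) = (i == k)%:R.
Proof.
move=> sfree; rewrite /coord -{1}[s i](rowK s) -row_mul mulmxV ?mxE //.
by rewrite -row_free_unit.
Qed.

Lemma continuous_coord s k : continuous (coord s k).
Proof.
rewrite (_ : coord s k =
    fun x => \sum_j x ord0 j * invmx (\matrix_i s i) j k); last first.
  by apply/funext => x; rewrite /coord mxE.
apply: continuous_sumr => j _ x.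
apply: (@continuousM R); last exact: cst_continuous.
exact: coord_continuous.
Qed.

(* [v = sum_l c l *: s l] keeps nonnegative coefficients when [s i] is replaced
   by [x] as soon as these numbers are nonnegative and [coord s i x > 0]. *)
Definition slack (s : 'I_m -> 'rV[R]_m) (c : 'I_m -> R) i l x : R :=
  c l * coord s i x - c i * coord s l x.

Lemma continuous_slack s c i l : continuous (slack s c i l).
Proof.
rewrite (_ : slack s c i l =
    (fun x => c l * coord s i x) \- (fun x => c i * coord s l x)) //.
move=> x; apply: continuousB; apply: (@continuousM R);
  by [exact: cst_continuous|exact: continuous_coord].
Qed.

Lemma slack_basis s c i j l : independent s ->
  slack s c i l (s j) = c l * (j == i)%:R - c i * (j == l)%:R.
Proof. by move=> sfree; rewrite /slack !coord_basis. Qed.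

Lemma slackE s c i l x : coord s i x != 0 ->
  c l - c i / coord s i x * coord s l x = slack s c i l x / coord s i x.
Proof. by move=> xi; rewrite /slack mulrBl mulfK // mulrAC. Qed.

(** The basis vectors are replaced one by one by nearby points of [K]; coefficients depend
    continuously on the new vector, so they stay positive. In the induction, [n] counts the vectors
    already in [K]. *)
Lemma cone_interior_closure K (s : 'I_m -> 'rV[R]_m) (c : 'I_m -> R) :
  K 0 -> (forall u v, K u -> K v -> K (u + v)) ->
  (forall k u, 0 < k -> K u -> K (k *: u)) ->
  independent s -> (forall i, closure K (s i)) -> (forall i, 0 < c i) ->
  K (\sum_(i < m) c i *: s i).
Proof.
move=> K0 KD KZ sfree sK c0.
suff step n : (n <= m)%N -> exists (c' : 'I_m -> R) (s' : 'I_m -> 'rV[R]_m),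
    [/\ forall i, 0 < c' i, forall i, closure K (s' i), independent s',
      forall i : 'I_m, (i < n)%N -> K (s' i)
      & \sum_(i < m) c i *: s i = \sum_(i < m) c' i *: s' i].
  have [c' [s' [c'0 _ _ s'K ->]]] := step m (leqnn m).
  by elim/big_ind: _ => // i _; apply: KZ => //; exact: s'K.
elim: n => [|n IH] nm; first by exists c, s; split.
have [c' [s' [c'0 s'cl s'free s'K ->]]] := IH (ltnW nm).
pose i := Ordinal nm.
(* At [s' i] the coordinate is 1 and each slack is [c' l], so these strict inequalities persist
   nearby. *)
have : nbhs (s' i) [set x | forall l, if l == i then 0 < coord s' i x
    else 0 < slack s' c' i l x].
  apply: (@filter_forall _ _ (fun l => [set x | if l == i then 0 < coord s' i x
    else 0 < slack s' c' i l x]) (nbhs (s' i)) _) => l /=; case: eqVneq => [_|li].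
    apply: (cvgr_gt _ (@continuous_coord s' i (s' i))).
    by rewrite coord_basis // eqxx ltr01.
  apply: (cvgr_gt _ (@continuous_slack s' c' i l (s' i))).
  by rewrite slack_basis // eqxx eq_sym (negbTE li) mulr1 mulr0 subr0.
move=> /(s'cl i)[x [Kx xpos]].
have xi : 0 < coord s' i x by have := xpos i; rewrite eqxx.
have xi0 : coord s' i x != 0 by rewrite gt_eqF.
have sxE : subst_at s' i x = subst_at s' i (\sum_k coord s' k x *: s' k).
  by rewrite -coord_sum.
exists (subst_at (fun k => c' k - c' i / coord s' i x * coord s' k x) i
  (c' i / coord s' i x)), (subst_at s' i x); split => [l|l||l ln|].
- rewrite /subst_at; case: eqVneq => [_|li]; first by rewrite divr_gt0.
  by rewrite slackE // divr_gt0 //; have := xpos l; rewrite (negbTE li).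
- by rewrite /subst_at; case: eqP => // _; exact: subset_closure.
- by rewrite sxE; exact: subst_independent.
- rewrite /subst_at; case: eqVneq => // li; apply: s'K.
  by rewrite ltn_neqAle -ltnS ln andbT; apply: contraNneq li => ?; exact/eqP/val_inj.
- by rewrite sxE; exact: subst_sum.
Qed.

(** The least slack is positive at [s i] and negative or zero at [s j], so it vanishes at some [x]
    on the path. If [x] has a positive coordinate at [i], putting it in place of [s i] cancels
    another coefficient. *)
Lemma path_reduction S (e : 'rV[R]_m) (s : 'I_m -> 'rV[R]_m) (c : 'I_m -> R) i j :
  (forall u, S u -> 0 <= dot e u) -> ~ S 0 ->
  independent s -> (forall k, S (s k)) -> (forall k, 0 < dot e (s k)) ->
  (forall k, 0 < c k) -> i != j -> path_joined R S (s i) (s j) ->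
  exists2 n, (n < m)%N & pos_comb S n (\sum_(k < m) c k *: s k).
Proof.
move=> eS S0 sfree Ss es c0 ij [g [gc g0 g1 gS]].
(* The default 1 is positive, so a zero of [H] is a zero of some slack. *)
pose H x := \big[Num.min/1]_(l < m | l != i) slack s c i l x.
have Hc : {within `[0, 1], continuous (H \o g)}.
  apply: within_continuous_comp gc => x _.
  by apply: continuous_bigmin => l _; exact: continuous_slack.
have H0 : 0 < H (g 0).
  rewrite g0 /H; apply/bigmin_gtP; split=> [|l li]; first exact: ltr01.
  by rewrite slack_basis // eqxx eq_sym (negbTE li) mulr1 mulr0 subr0.
have H1 : H (g 1) <= 0.
  rewrite g1 /H; apply: (@le_trans _ _ (slack s c i j (s j))).
    by apply: bigmin_le_cond; rewrite eq_sym.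
  by rewrite slack_basis // eqxx eq_sym (negbTE ij) mulr0 sub0r mulr1 oppr_le0 ltW.
have [|t t01 Ht] := IVT ler01 Hc (v := 0).
  by rewrite /= ge_min le_max H1 (ltW H0) orbT.
pose x := g t; have Hx : H x = 0 := Ht.
have Sx : S x by apply: gS; exists t.
have slack_ge0 l : l != i -> 0 <= slack s c i l x.
  move=> li; have : 0 <= H x by rewrite Hx.
  by move=> /bigmin_geP[_ /(_ l li)].
have [l li lx] : exists2 l, l != i & slack s c i l x = 0.
  apply: contrapT => h; suff : 0 < H x by rewrite Hx ltxx.
  apply/bigmin_gtP; split=> [|l li]; first exact: ltr01.
  rewrite lt_neqAle slack_ge0 // andbT eq_sym; apply/eqP => lx; apply: h.
  by exists l.
have [xi|xi] := ltP 0 (coord s i x).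
  have xi0 : coord s i x != 0 by rewrite gt_eqF.
  rewrite (subst_sum _ _ xi0) -coord_sum //; apply: (@pos_comb_drop _ _ _ _ _ _ l).
  - move=> k; rewrite /subst_at; case: eqVneq => [_|ki].
      by rewrite divr_ge0 // ltW.
    by rewrite slackE // divr_ge0 ?slack_ge0 // ltW.
  - by move=> k _; rewrite /subst_at; case: ifP.
  - by rewrite /subst_at (negbTE li) slackE // lx mul0r.
(* Otherwise [x] is a nonpositive combination of the [s k], on which [e] is
   positive, although [e] is nonnegative at [x]. *)
have x_le0 k : coord s k x <= 0.
  have [->//|ki] := eqVneq k i.
  rewrite -(pmulr_rle0 _ (c0 i)); apply: le_trans (_ : c k * coord s i x <= 0).
    by rewrite -subr_ge0 slack_ge0.
  by rewrite pmulr_rle0.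
case: S0; suff <- : x = 0 by [].
have terms k : 0 <= - (coord s k x * dot e (s k)).
  by rewrite oppr_ge0 pmulr_lle0.
(* The sum is [- dot e x], at most 0, while its terms are nonnegative: all vanish, and with them the
   coordinates of [x]. *)
have /eqP : \sum_(k < m) - (coord s k x * dot e (s k)) = 0.
  apply/le_anti; rewrite sumr_ge0 ?andbT; last by move=> k _; exact: terms.
  rewrite sumrN oppr_le0 (le_trans (eS _ Sx)) //.
  rewrite {1}(coord_sum x sfree) dot_sumr.
  by apply: ler_sum => k _; rewrite dotZr.
rewrite psumr_eq0 => [/allP xk0|k _]; last exact: terms.
rewrite (coord_sum x sfree) big1 // => k _.
have := xk0 k (mem_index_enum k); rewrite /= oppr_eq0 mulf_eq0.
by rewrite (gt_eqF (es k)) orbF => /eqP ->; rewrite scale0r.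
Qed.

End Bases.

(** * Mixture vectors, their cone and its Caratheodory number *)

Section MixVectors.
Variables (R : realType) (X : ptopologicalType) (M : metricType R).
Variables (Sigma : set M) (delta : X -> M -> probability (borel X) R).
Variables (m : nat) (a : 'I_m -> X -> R).
Local Notation S := (normalized_range Sigma delta a).

(** Linearity of the integral; it carries the sign of a combination of the [a i] over to the mixture
    vectors. *)
Lemma dot_mix_vec (f : 'rV[R]_m) x s :
  (forall i, (delta x s).-integrable [set: borel X] (EFin \o a i)) ->
  dot f (mix_vec delta a x s) =
  \int[delta x s]_(y in [set: borel X]) \sum_(i < m) f ord0 i * a i y.
Proof.
move=> a_int.
have int_term i : (delta x s).-integrable [set: borel X]
    (EFin \o (fun y => f ord0 i * a i y)).
  exact: (integrableZl measurableT (f ord0 i) (a_int i)).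
rewrite /dot; elim: (index_enum 'I_m) => [|i r IH].
  rewrite big_nil /Rintegral; under eq_integral do rewrite big_nil.
  by rewrite integral0.
under [RHS]eq_Rintegral do rewrite big_cons.
rewrite big_cons IH mxE RintegralD //; first by rewrite RintegralZl.
rewrite (_ : _ \o _ =
    fun y => (\sum_(j <- r) (f ord0 j * a j y)%:E)%E); last first.
  by apply/funext => y /=; rewrite sumEFin.
by apply: (@integrable_sum _ (borel X) R (delta x s) _ measurableT _ r xpredT
  (fun j y => (f ord0 j * a j y)%:E)) => j _; exact: int_term.
Qed.

Lemma eucl_norm_gt0 (v : 'rV[R]_m) : v != 0 -> 0 < eucl_norm v.
Proof.
move=> v0; rewrite sqrtr_gt0 lt_neqAle sumr_ge0 ?andbT; last first.
  by move=> i _; rewrite sqr_ge0.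
apply: contra v0 => /eqP v0; apply/eqP/dot_eq0.
by rewrite /dot (_ : \sum_(i < m) _ = 0) // [RHS]v0; apply: eq_bigr => i _; rewrite expr2.
Qed.

Lemma normalized_range_neq0 : ~ S 0.
Proof.
move=> [x [s [_ v0 /esym/eqP]]]; rewrite scaler_eq0 invr_eq0 (negbTE v0) orbF.
by rewrite gt_eqF // eucl_norm_gt0.
Qed.

(** The norms are absorbed by the coefficients; a term with zero coefficient or zero vector becomes
    an empty combination. *)
Lemma mix_cone_pos_comb v : mix_cone Sigma delta a v -> exists n, pos_comb S n v.
Proof.
move=> [n [c [x [s [c0 Ss ->]]]]]; apply: pos_comb_sum => i.
have [ci|ci] := eqVneq (c i) 0.
  by exists 0%N; rewrite ci scale0r; exact: pos_comb0.
have [v0|v0] := eqVneq (mix_vec delta a (x i) (s i)) 0.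
  by exists 0%N; rewrite v0 scaler0; exact: pos_comb0.
have N0 := eucl_norm_gt0 v0.
set u := mix_vec _ _ _ _ in v0 N0 *.
exists 1%N, (fun=> c i * eucl_norm u), (fun=> (eucl_norm u)^-1 *: u).
split=> [_|_|]; first by rewrite mulr_gt0 // lt_neqAle eq_sym ci c0.
  by exists (x i), (s i); split.
by rewrite big_ord1 scalerA mulfK // gt_eqF.
Qed.

Lemma pos_comb_has_atoms v k : pos_comb S k v -> has_atoms Sigma delta a v k.
Proof.
move=> [c [u [c0 Su ->]]].
have /choice[xs xsP] i : exists p : X * M, [/\ Sigma p.2,
    mix_vec delta a p.1 p.2 != 0 &
    u i = (eucl_norm (mix_vec delta a p.1 p.2))^-1 *: mix_vec delta a p.1 p.2].
  by have [x [s h]] := Su i; exists (x, s).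
exists (fun i => c i / eucl_norm (mix_vec delta a (xs i).1 (xs i).2)),
  (fun i => (xs i).1), (fun i => (xs i).2); split=> [i|i|].
- by have [_ h _] := xsP i; rewrite divr_gt0 // eucl_norm_gt0.
- by have [] := xsP i.
- by apply: eq_bigr => i _; have [_ _ ->] := xsP i; rewrite scalerA.
Qed.

(** The attained values form a set of naturals bounded by [b], nonempty because the cone contains 0,
    so the maximum exists. *)
Lemma is_cara_number_bounded b :
  (forall v, mix_cone Sigma delta a v ->
     exists2 k, (k <= b)%N & has_atoms Sigma delta a v k) ->
  exists n, is_cara_number Sigma delta a n /\ (n <= b)%N.
Proof.
move=> atoms.
have cara v : mix_cone Sigma delta a v ->
    exists2 k, is_cara_number_at Sigma delta a v k & (k <= b)%N.
  move=> /atoms[k kb vk].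
  have ex_k : exists k, `[< has_atoms Sigma delta a v k >].
    by exists k; apply/asboolP.
  case: (ex_minnP ex_k) => k0 /asboolP vk0 k0min.
  have k0b : (k0 <= b)%N by apply: leq_trans kb; apply: k0min; apply/asboolP.
  exists k0 => //.
  by split=> // l /asboolP; exact: k0min.
pose attained k := exists2 v, mix_cone Sigma delta a v &
  is_cara_number_at Sigma delta a v k.
have ex_k : exists k, `[< attained k >].
  have cone0 : mix_cone Sigma delta a 0.
    have no_param : 'I_0 -> M by case.
    exists 0%N, (fun=> 0), (fun=> point), no_param.
    by split=> [[]|[]|]; rewrite ?big_ord0.
  by have [k vk _] := cara 0 cone0; exists k; apply/asboolP; exists 0.
have bounded k : `[< attained k >] -> (k <= b)%N.
  move=> /asboolP[v /cara[l [vl lmin] lb] [vk kmin]].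
  exact: leq_trans (kmin _ vl) lb.
case: (ex_maxnP ex_k bounded) => n /asboolP nP nmax; exists n; split.
  split=> // v cv; have [k vk kb] := cara v cv; exists k => //.
  by apply: nmax; apply/asboolP; exists v.
by apply: bounded; apply/asboolP.
Qed.

End MixVectors.

(** * Counting path components, and the bound itself *)

(** If no two were joined, the sets reached from the [s i] would be [m] distinct path components. *)
Lemma path_joined_pigeonhole (R : realType) (T : topologicalType) (S : set T)
    (m k : nat) (s : 'I_m -> T) :
  (k < m)%N -> (path_components R S #<= `I_k)%card -> (forall i, S (s i)) ->
  exists i j, i != j /\ path_joined R S (s i) (s j).
Proof.
move=> km few Ss; apply: contrapT => nojoin.
pose F i := [set v | path_joined R S (s i) v].
have Finj : {in [set: 'I_m] &, injective F}.
  move=> i j _ _ Fij; apply: contrapT => /eqP ij; apply: nojoin; exists i, j.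
  split=> //; suff : F i (s j) by [].
  (* The constant path puts [s j] in its own component. *)
  rewrite Fij; exists (fun=> s j); split=> //; last by move=> _ [t _ <-].
  by move=> x; exact: cst_continuous.
have : (F @` [set: 'I_m] #<= path_components R S)%card.
  by apply: subset_card_le => _ [i _ <-]; exists (s i).
move=> /card_le_trans/(_ few).
have Im : ([set: 'I_m] #= `I_m)%card.
  have -> : `I_m = (fun i : 'I_m => i : nat) @` [set: 'I_m].
    apply/seteqP; split=> [i im|_ [i _ <-]]; last exact: ltn_ord.
    by exists (Ordinal im).
  by rewrite card_eq_sym; apply: inj_card_eq => i j _ _; exact: ord_inj.
rewrite (card_le_eql (inj_card_eq Finj)) (card_le_eql Im) card_le_II.
by rewrite leqNgt km.
Qed.

Lemma cvg_within_sequence (T : topologicalType) (A : set T) (x : T) (u : nat -> T) :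
  (forall n, A (u n)) -> u @ \oo --> x -> u @ \oo --> within A (nbhs x).
Proof.
move=> uA ux B /ux; apply: (@filterS _ \oo _ (fun n => A (u n) -> B (u n))).
by move=> n; apply; exact: uA.
Qed.

Theorem theorem31 (R : realType) (X : ptopologicalType) (M : metricType R)
  (Sigma : set M) (delta : X -> M -> probability (borel X) R)
  (m : nat) (m_gt0 : (0 < m)%N) (a : 'I_m -> X -> R)
  (a_cont : forall i, continuous (a i))
  (a_indep : lin_indep a)
  (a_int : forall i x s, Sigma s ->
     (delta x s).-integrable [set: borel X] (EFin \o a i))
  (s0 : M) (s0_closure : closure Sigma s0)
  (mix_lim : forall i x,
     mix delta a i x s @[s --> within Sigma (nbhs s0)] --> a i x)
  (sigma : nat -> M) (sigma_Sigma : forall n, Sigma (sigma n))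
  (sigma_cvg : sigma @ \oo --> s0)
  (e_pos : exists (e : X -> M -> R) (N : nat),
     in_lin_mix Sigma delta a e /\
     forall (x : X) (i : nat), (N <= i)%N -> 0 < e x (sigma i))
  (few_components :
     (path_components R (normalized_range Sigma delta a) #<= `I_(m - 1))%card) :
  exists n : nat, is_cara_number Sigma delta a n /\ (n <= m - 1)%N.
Proof.
case: e_pos => e [N [[c eE] e_gt0]].
pose ev : 'rV[R]_m := \row_i c i.
pose S := normalized_range Sigma delta a.
pose t := mix_vec delta a.
have ev_t x s : Sigma s -> dot ev (t x s) = e x s.
  by move=> Ss; rewrite eE //; apply: eq_bigr => i _; rewrite !mxE.
(* Stated for any functional, since it serves twice: for [ev], and for the functionals nonnegative
   on [K]. *)
have dot_t_ge0 (f : 'rV[R]_m) : (forall x n, (N <= n)%N -> 0 <= dot f (t x (sigma n))) ->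
    forall x s, Sigma s -> 0 <= dot f (t x s).
  move=> f_ge0.
  have fa y : 0 <= \sum_(i < m) f ord0 i * a i y.
    have lim_y : dot f (t y (sigma n)) @[n --> \oo] --> \sum_(i < m) f ord0 i * a i y.
      apply: cvg_big => [|i _].
        by move=> [u v]; exact: (@cvgD _ R^o _ _ _ fst snd u v cvg_fst cvg_snd).
      apply: (@cvgMr R); under eq_fun do rewrite mxE.
      apply: (cvg_comp sigma (mix delta a i y)); last exact: mix_lim.
      exact: cvg_within_sequence.
    rewrite -(cvg_lim _ lim_y) //; apply: limr_ge; first by apply/cvg_ex; eexists; exact: lim_y.
    by exists N => // n /= Nn; exact: f_ge0.
  move=> x s Ss; rewrite dot_mix_vec; last by move=> i; exact: a_int.
  by apply: Rintegral_ge0 => y _; exact: fa.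
have ev_S u : S u -> 0 <= dot ev u.
  move=> [x [s [Ss u0 ->]]]; rewrite dotZr mulr_ge0 //.
    by rewrite invr_ge0 ltW // eucl_norm_gt0.
  by apply: dot_t_ge0 => // y n Nn; rewrite ev_t // ltW // e_gt0.
pose Spos := S `&` [set u | 0 < dot ev u].
pose K := [set v | exists n, pos_comb Spos n v].
have K0 : K 0 by exists 0%N; exact: pos_comb0.
have KD u v : K u -> K v -> K (u + v).
  by move=> [k ku] [l lv]; exists (k + l)%N; exact: pos_combD.
have KZ k u : 0 < k -> K u -> K (k *: u).
  by move=> k0 [n nu]; exists n; exact: pos_combZ.
have Kt x n : (N <= n)%N -> K (t x (sigma n)).
  move=> Nn; have tpos : 0 < dot ev (t x (sigma n)) by rewrite ev_t // e_gt0.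
  have t0 : t x (sigma n) != 0.
    by apply: contraTneq tpos => ->; rewrite dot0r ltxx.
  have norm_gt0 := eucl_norm_gt0 t0.
  exists 1%N, (fun=> eucl_norm (t x (sigma n))),
    (fun=> (eucl_norm (t x (sigma n)))^-1 *: t x (sigma n)); split=> // [_|].
    split; first by exists x, (sigma n); split.
    by rewrite /= dotZr mulr_gt0 // invr_gt0.
  by rewrite big_ord1 scalerA divff ?scale1r // gt_eqF.
have S_closure u : S u -> closure K u.
  move=> [x [s [Ss u0 ->]]]; apply: closure_bipolar => // f fK.
  rewrite dotZr mulr_ge0 //; first by rewrite invr_ge0 ltW // eucl_norm_gt0.
  by apply: dot_t_ge0 => // y n Nn; apply: fK; exact: Kt.
apply: is_cara_number_bounded => v /mix_cone_pos_comb[n0 vS].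
suff [k km vk] : exists2 k, (k < m)%N & pos_comb S k v.
  exists k; last exact: pos_comb_has_atoms.
  by rewrite subn1 -ltnS prednK.
have [k [d [s [d0 Ss vE sfree]]]] := caratheodory vS.
have [km|mk] := ltnP k m; first by exists k => //; exists d, s; split.
have km : k = m by apply/eqP; rewrite eqn_leq mk (independent_size sfree).
subst k.
(* The first basis, in [S], only serves to place [v] in [K]. *)
have [n1 vpos] : K v.
  rewrite vE; apply: (cone_interior_closure K0 KD KZ sfree _ d0) => i.
  exact: S_closure (Ss i).
(* A second reduction, inside [Spos], gives a basis on which [ev] is positive, as the path argument
   requires. *)
clear d s d0 Ss vE sfree mk; have [k [d [s [d0 Ss vE sfree]]]] := caratheodory vpos.
have [km|mk] := ltnP k m.
  by exists k => //; exists d, s; split=> // i; have [] := Ss i.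
have km : k = m by apply/eqP; rewrite eqn_leq mk (independent_size sfree).
subst k.
(* Subtraction is truncated, so [0 < m] matters here. *)
have m1 : (m - 1 < m)%N by rewrite subn1 prednK.
have sS i : S (s i) by case: (Ss i).
have [i [j [ij joined]]] := path_joined_pigeonhole m1 few_components sS.
rewrite vE; apply: (path_reduction ev_S _ _ _ _ _ ij joined) => //.
  exact: normalized_range_neq0.
by move=> l; case: (Ss l).
Qed.
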